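(* Let $\mathbf{P}$ be the routing matrix of the bike sharing system with $N$ stations, irreducible path graph, first-trip probabilities $p_{i,j}$, retrial probabilities $\alpha_{i,j}$ and full-station probabilities $\pi_{i,K}$, as defined in the context. Then the (finite) matrix $\mathbf{P}$ is irreducible and stochastic, and there exists a unique positive solution $\overrightarrow{e}$ (a real row vector indexed by the virtual nodes, with road nodes counted once for each class) to the system of linear equations $$\overrightarrow{e}=\overrightarrow{e}\,\mathbf{P},\qquad e_1=1,$$ where $e_1$ is the first entry of $\overrightarrow{e}$, i.e. the entry corresponding to Station $1$.
   Context: Stations and roads. There are $N\ge 2$ stations, labelled $1,\dots,N$, and a set of directed roads; a road from Station $i$ to Station $j$ ($i\ne j$) is written Road $i\to j$, and there is at most one road for each ordered pair $(i,j)$. For each $i$ put $\Theta_i=\{j : \text{Road } i\to j \text{ exists}\}$ (stations immediately downstream of $i$). Irreducible path graph. Consider the directed graph whose nodes are all stations and all roads, with an arc from Station $i$ to Road $i\to j$ and an arc from Road $i\to j$ to Station $j$, for every existing Road $i\to j$. The path graph is called irreducible if for any two nodes (stations or roads) of this graph there is a directed path from the first to the second. The path graph is assumed to be irreducible. Probabilities. A user renting a bike at Station $i$ takes Road $i\to j$, $j\in\Theta_i$, with probability $p_{i,j}>0$, where $\sum_{j\in\Theta_i}p_{i,j}=1$. A user who arrives with a bike at Station $l$ and finds it full (no vacant parking position) rides on along Road $l\to j$, $j\in\Theta_l$, with probability $\alpha_{l,j}>0$, where $\sum_{j\in\Theta_l}\alpha_{l,j}=1$. For each station $i$, $\pi_{i,K}$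 is a constant with $0<\pi_{i,K}<1$ (the steady-state probability that Station $i$, which has $K$ parking positions, is full). Classes. On each road there are two classes of virtual customers (bikes): class 1 consists of bikes being ridden on their first road since being rented; class 2 consists of bikes whose rider has already been turned away from at least one full station. The routing matrix is indexed by the set consisting of the $N$ stations together with all pairs (Road $i\to j$, class $r$), $r\in\{1,2\}$. Routing matrix. The entries of $\mathbf{P}=(p_{\widetilde{i},\widetilde{j}})$ are: - from Station $i$ to (Road $i\to j$, class 1), $j\in\Theta_i$: $p_{i,j}$; - from (Road $i\to j$, class $r$), $r=1,2$, to Station $j$: $1-\pi_{j,K}$; - from (Road $i\to l$, class $r$), $r=1,2$, to (Road $l\to j$, class 2), $j\in\Theta_l$ (with $j=i$ allowed): $\alpha_{l,j}\,\pi_{l,K}$; - all other entries are $0$. The vector $\overrightarrow{e}$ is the vector of relative arrival rates of the corresponding closed queueing network. *)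

(* Defs.v *)
From mathcomp Require Import all_boot all_order all_algebra.
From mathcomp Require Import reals.

Set Implicit Arguments.
Unset Strict Implicit.
Unset Printing Implicit Defensive.

Import Order.TTheory GRing.Theory Num.Theory.
Local Open Scope ring_scope.

(* Station k (k = 1, ..., N) is the element of ['I_N] of
   value k - 1; [road i j] says that Road i -> j exists. *)

Section Network.
Variables (N : nat) (road : rel 'I_N).

Definition Theta (i : 'I_N) : {set 'I_N} := [set j | road i j].

Definition road_node : finType := {e : 'I_N * 'I_N | road e.1 e.2}.

Definition tail (e : road_node) : 'I_N := (val e).1.
Definition head (e : road_node) : 'I_N := (val e).2.

Definition path_node : finType := ('I_N + road_node)%type.

Definition path_arc : rel path_node := fun x y =>
  match x, y with
  | inl i, inr e => tail e == i
  | inr e, inl j => head e == j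
  | _, _ => false
  end.

Definition irreducible_path_graph : Prop :=
  forall x y : path_node, connect path_arc x y.

(* The boolean attached to a road is the class: [false] for class 1 (first
   ride), [true] for class 2 (turned away from at least one full station). *)
Definition vnode : finType := ('I_N + road_node * bool)%type.

Definition station (i : 'I_N) : vnode := inl i.

Variables (R : realType) (p alpha : 'I_N -> 'I_N -> R) (piK : 'I_N -> R).

Definition routing (x y : vnode) : R :=
  match x, y with
  | inl i, inr (f, s) =>
      if (tail f == i) && ~~ s then p i (head f) else 0
  | inr (e, _), inl j =>
      if head e == j then 1 - piK j else 0
  | inr (e, _), inr (f, s) =>
      if (tail f == head e) && s
      then alpha (head e) (head f) * piK (head e) else 0
  | inl _, inl _ => 0
  end.

Definition routing_mx : 'M[R]_#|vnode| :=
  \matrix_(a, b) routing (enum_val a) (enum_val b).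

End Network.

Definition stochastic (R : realType) (n : nat) (A : 'M[R]_n) : Prop :=
  (forall i j, 0 <= A i j) /\ (forall i, \sum_j A i j = 1).

(* Meaningful for nonnegative [A]; [k = 0] is excluded, as [A ^+ 0] always has
   a positive diagonal. *)
Definition irreducible_mx (R : realType) (n : nat) (A : 'M[R]_n) : Prop :=
  forall i j, exists2 k : nat, (0 < k)%N & 0 < (A ^+ k) i j.

(* Main.v *)
Require Import Defs.
From mathcomp Require Import all_boot all_order all_algebra.
From mathcomp Require Import reals.

(** The routing matrix [P] is the transition matrix of a Markov chain on the
    virtual nodes, and the theorem splits into combinatorics and the theory of
    finite irreducible chains.

    Stochasticity ([routing_row_sum]): the outgoing mass of a station is the
    sum of the [p i j]; that of a road leading to [j] is [1 - piK j] plus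
    [piK j] times the sum of the [alpha j k].

    Irreducibility: a walk in the path graph lifts to a walk of positive
    probability that stays in class 1, since a station sends bikes to class 1
    roads and a road of either class releases them at the station it leads to.
    The class 2 copy of a road is entered from any road leading to its tail,
    and left towards its head; hence every virtual node reaches every other
    one ([routing_connected]), and concatenating positive transitions makes
    powers of [P] positive entry by entry ([connected_irreducible]).

    Stationary vector: the rows of [P] sum to 1, so [P - 1] is singular and a
    nonzero [v] with [v = v P] exists ([stationary_exists]). By the triangle
    inequality the vector of absolute values satisfies [|v| <= |v| P]
    entrywise, and both sides have the same total because [P] is stochastic;
    so [|v|] is again stationary ([stationary_norm]). Irreducibility spreads
    positivity from one entry to all ([stationary_gt0]), and rescaling [|v|]
    gives existence. The same two facts give uniqueness: the difference of two
    normalized solutions is stationary and vanishes at Station 1, but the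
    absolute value of a nonzero stationary vector vanishes nowhere
    ([stationary_vanish]). *)

Set Implicit Arguments.
Unset Strict Implicit.
Unset Printing Implicit Defensive.

Import Order.TTheory GRing.Theory Num.Theory.
Local Open Scope ring_scope.

(** * Reachability in finite digraphs *)

Lemma homo_connect (T T' : finType) (e : rel T) (e' : rel T') (f : T -> T') :
  (forall x y, e x y -> connect e' (f x) (f y)) ->
  forall x y, connect e x y -> connect e' (f x) (f y).
Proof.
move=> ef x y /connectP[s + ->].
elim: s x => [|z s IHs] x /=; first by rewrite connect0.
by case/andP=> /ef exz /IHs; apply: connect_trans.
Qed.

Lemma connect_pred (T : finType) (e : rel T) (x y : T) :
  connect e x y -> x != y -> exists z, e z y.
Proof.
move=> /connectP[s]; case/lastP: s => [_ -> /eqP//|s z].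
by rewrite rcons_path last_rcons => /andP[_ ez] -> _; exists (last x s).
Qed.

(** * Stationary vectors of irreducible stochastic matrices *)

Section StochasticMatrix.
Variables (R : realType) (n : nat) (A : 'M[R]_n).
Hypothesis Ast : stochastic A.

Lemma stochastic_expr_ge0 k i j : 0 <= (A ^+ k) i j.
Proof.
elim: k i j => [|k IHk] i j; first by rewrite expr0 mxE; case: eqP.
rewrite exprS mxE; apply: sumr_ge0 => l _.
by rewrite mulr_ge0 ?IHk //; case: Ast.
Qed.

Lemma stochastic_exprS_gt0 k i l j :
  0 < A i l -> 0 < (A ^+ k) l j -> 0 < (A ^+ k.+1) i j.
Proof.
move=> Ail Alj; rewrite exprS mxE (bigD1 l) //= ltr_pwDl ?mulr_gt0 //.
apply: sumr_ge0 => m _; rewrite mulr_ge0 ?stochastic_expr_ge0 //.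
by case: Ast.
Qed.

Lemma stochastic_succ i : exists j, 0 < A i j.
Proof.
have [A_ge0 /(_ i) sum1] := Ast.
have /(psumr_neq0P (fun j _ => A_ge0 i j))[j /andP[_ Aij]] : \sum_j A i j <> 0.
  by rewrite sum1; apply/eqP/oner_neq0.
by exists j.
Qed.

(** The first step is taken separately because [connect] also accepts the
    empty walk, whereas irreducibility asks for a positive exponent. *)
Lemma connected_irreducible :
  (forall i j, connect [rel a b | 0 < A a b] i j) -> irreducible_mx A.
Proof.
move=> conn i j; have [l Ail] := stochastic_succ i.
suff [k Alj] : exists k, 0 < (A ^+ k) l j.
  by exists k.+1 => //; apply: stochastic_exprS_gt0 Ail Alj.
have /connectP[s + ->] := conn l j.
elim: s l {Ail} => [|m s IHs] l /=; first by exists 0; rewrite expr0 mxE eqxx.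
by case/andP=> Alm /IHs[k Ams]; exists k.+1; apply: stochastic_exprS_gt0 Ams.
Qed.

(** The constant column is a right null vector of [A - 1]; in finite
    dimension a left one exists as well. *)
Lemma stationary_exists (i0 : 'I_n) :
  exists2 v : 'rV[R]_n, v = v *m A & v != 0.
Proof.
have [_ sum1] := Ast.
pose c : 'cV[R]_n := const_mx 1.
have Bc0 : (A - 1%:M) *m c = 0.
  rewrite mulmxBl mul1mx; apply/matrixP => i j.
  rewrite !mxE -[X in _ - X](sum1 i).
  apply/eqP; rewrite subr_eq0; apply/eqP.
  by apply: eq_bigr => l _; rewrite mxE mulr1.
have : kermx (A - 1%:M) != 0.
  rewrite kermx_eq0 row_free_unit; apply/negP => Bunit.
  have /matrixP/(_ i0 0)/eqP : c = 0 by rewrite -(mulKmx Bunit c) Bc0 mulmx0.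
  by rewrite !mxE oner_eq0.
case/rowV0Pn=> v /sub_kermxP vB v_neq0; exists v => //.
by apply/eqP; rewrite eq_sym -subr_eq0 -[X in _ - X]mulmx1 -mulmxBr vB.
Qed.

(** A nonnegative vector keeps its total mass under [A], so the entrywise
    inequality [|v| <= |v| A] cannot be strict anywhere. *)
Lemma stationary_norm (v : 'rV[R]_n) :
  v = v *m A -> map_mx Num.norm v = map_mx Num.norm v *m A.
Proof.
have [A_ge0 sum1] := Ast; move=> vA; set u := map_mx _ v.
have u_le j : 0 <= (u *m A) 0 j - u 0 j.
  rewrite subr_ge0 [u 0 j]mxE [in leLHS]vA !mxE.
  apply: le_trans (ler_norm_sum _ _ _) _; apply: ler_sum => i _.
  by rewrite normrM mxE (ger0_norm (A_ge0 i j)).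
have total : \sum_j ((u *m A) 0 j - u 0 j) = 0.
  rewrite sumrB; apply/eqP; rewrite subr_eq0; apply/eqP.
  under eq_bigr do rewrite mxE; rewrite exchange_big /=.
  by apply: eq_bigr => i _; rewrite -mulr_sumr sum1 mulr1.
apply/rowP => j; apply/eqP; rewrite eq_sym -subr_eq0.
by rewrite (psumr_eq0P (fun j _ => u_le j) total).
Qed.

Hypothesis Airr : irreducible_mx A.

Lemma stationary_gt0 (u : 'rV[R]_n) (i : 'I_n) :
  (forall j, 0 <= u 0 j) -> u = u *m A -> u 0 i != 0 -> forall j, 0 < u 0 j.
Proof.
move=> u_ge0 uA ui j; have [k _ Aij] := Airr i j.
have -> : u = u *m (A ^+ k).
  elim: k {Aij} => [|k IHk]; first by rewrite expr0 mulmx1.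
  by rewrite exprSr -mulmxE mulmxA -IHk.
have ui_gt0 : 0 < u 0 i by rewrite lt0r ui u_ge0.
rewrite mxE (bigD1 i) //= ltr_pwDl ?mulr_gt0 //.
by apply: sumr_ge0 => l _; rewrite mulr_ge0 ?stochastic_expr_ge0.
Qed.

Lemma stationary_norm_gt0 (v : 'rV[R]_n) (i : 'I_n) :
  v = v *m A -> v 0 i != 0 -> forall j, 0 < `|v 0 j|.
Proof.
move=> /stationary_norm uA vi j.
have := @stationary_gt0 (map_mx Num.norm v) i _ uA _ j; rewrite !mxE; apply.
  by move=> l; rewrite mxE.
by rewrite normr_eq0.
Qed.

Lemma stationary_vanish (v : 'rV[R]_n) (i : 'I_n) :
  v = v *m A -> v 0 i = 0 -> v = 0.
Proof.
move=> vA vi; apply/rowP => j; rewrite mxE; apply/eqP/negPn/negP => vj.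
by have := stationary_norm_gt0 vA vj i; rewrite vi normr0 ltxx.
Qed.

Lemma stationary_exists_unique (i0 : 'I_n) :
  exists! e : 'rV[R]_n, [/\ forall j, 0 < e 0 j, e = e *m A & e 0 i0 = 1].
Proof.
have [v vA /rV0Pn[i vi]] := stationary_exists i0.
have v_gt0 := stationary_norm_gt0 vA vi.
exists (`|v 0 i0|^-1 *: map_mx Num.norm v); split.
  split=> [j||]; last by rewrite !mxE mulVf // gt_eqF.
    by rewrite !mxE mulr_gt0 ?invr_gt0.
  by rewrite -scalemxAl -stationary_norm.
move=> e [_ eA e1]; apply/eqP; rewrite -subr_eq0; apply/eqP.
apply: (@stationary_vanish _ i0).
  by rewrite mulmxBl -eA -scalemxAl -stationary_norm.
by rewrite !mxE e1 mulVf ?subrr // gt_eqF.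
Qed.

End StochasticMatrix.

(** * The routing matrix of the bike sharing network *)

Section Routing.
Variables (R : realType) (N : nat) (road : rel 'I_N).
Variables (p alpha : 'I_N -> 'I_N -> R) (piK : 'I_N -> R).
Hypothesis p_gt0 : forall i j, j \in Theta road i -> 0 < p i j.
Hypothesis p_sum1 : forall i, \sum_(j in Theta road i) p i j = 1.
Hypothesis alpha_gt0 : forall i j, j \in Theta road i -> 0 < alpha i j.
Hypothesis alpha_sum1 : forall i, \sum_(j in Theta road i) alpha i j = 1.
Hypothesis piK_itv : forall i, 0 < piK i < 1.

(* Unqualified, [head] is the first item of a sequence. *)
Local Notation head := Defs.head.
Local Notation routing := (@routing N road R p alpha piK).
Local Notation routes := [rel x y | 0 < routing x y].

Lemma head_Theta (f : road_node road) : head f \in Theta road (tail f).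
Proof. by rewrite inE; exact: (valP f). Qed.

Lemma sum_roads_from (i : 'I_N) (g : 'I_N -> R) :
  \sum_(f : road_node road | tail f == i) g (head f)
  = \sum_(j in Theta road i) g j.
Proof.
have := big_sub_cond (fun e : 'I_N * 'I_N => road e.1 e.2)
  (fun e => e.1 == i) (fun e => g e.2) => <-.
rewrite -(big_pred1_eq +%R i (fun k => \sum_(j in Theta road k) g j)).
rewrite pair_big_dep /=; apply: eq_bigl => -[k j] /=.
by rewrite unfold_in inE andbC.
Qed.

Lemma routing_ge0 x y : 0 <= routing x y.
Proof.
case: x y => [i|[e r]] [j|[f s]] //=.
- by case: ifP => // /andP[/eqP<- _]; apply/ltW/p_gt0/head_Theta.
- by case: ifP => // _; rewrite subr_ge0 ltW; have /andP[] := piK_itv j.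
- case: ifP => // /andP[/eqP<- _]; apply: mulr_ge0.
    exact/ltW/alpha_gt0/head_Theta.
  by rewrite ltW; have /andP[] := piK_itv (tail f).
Qed.

Lemma routing_row_sum x : \sum_y routing x y = 1.
Proof.
rewrite big_sumType /=.
have -> : \sum_z routing x (inr z) = \sum_f \sum_s routing x (inr (f, s)).
  by rewrite pair_bigA; apply: eq_bigr => -[].
case: x => [i|[e r]].
  rewrite big1 ?add0r //; under eq_bigr do rewrite big_bool /= andbF andbT add0r.
  by rewrite -big_mkcond sum_roads_from.
under [in X in _ + X]eq_bigr do rewrite big_bool /= andbF andbT addr0.
rewrite -!big_mkcond /= (big_pred1 (head e)) => [|j]; last by rewrite eq_sym.
by rewrite -mulr_suml sum_roads_from alpha_sum1 mul1r subrK.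
Qed.

Lemma routing_mx_stochastic : stochastic (routing_mx road p alpha piK).
Proof.
split=> [a b|a]; first by rewrite mxE routing_ge0.
under eq_bigr do rewrite mxE.
rewrite -(routing_row_sum (enum_val a)).
by rewrite -(big_enum_val (fun y => routing (enum_val a) y)); apply: eq_bigl.
Qed.

Lemma routes_station_road (f : road_node road) :
  routes (inl (tail f)) (inr (f, false)).
Proof. by rewrite /= eqxx p_gt0 ?head_Theta. Qed.

Lemma routes_road_station (e : road_node road) r :
  routes (inr (e, r)) (inl (head e)).
Proof. by rewrite /= eqxx subr_gt0; have /andP[] := piK_itv (head e). Qed.

Lemma routes_road_road (e f : road_node road) r :
  tail f = head e -> routes (inr (e, r)) (inr (f, true)).
Proof.
move=> /= fe; rewrite fe eqxx mulr_gt0 //; last first.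
  by have /andP[] := piK_itv (head e).
by apply: alpha_gt0; rewrite -fe head_Theta.
Qed.

Definition class1_lift (x : path_node road) : vnode road :=
  match x with inl i => inl i | inr e => inr (e, false) end.

Hypothesis path_irr : irreducible_path_graph road.

Lemma class1_lift_connect x y :
  connect routes (class1_lift x) (class1_lift y).
Proof.
apply: homo_connect (path_irr x y) => {x y} -[i|e] [j|f] //= /eqP <-.
  exact/connect1/routes_station_road.
exact/connect1/routes_road_station.
Qed.

(** Irreducibility of the path graph makes some road lead to the tail of any
    given road; a refusal there is what feeds class 2. *)
Lemma road_into (f : road_node road) :
  exists e : road_node road, head e = tail f.
Proof.
have [//|[i|e] //= /eqP ef] := connect_pred (path_irr (inr f) (inl (tail f))).
by exists e.
Qed.

Lemma routing_connected x y : connect routes x y.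
Proof.
have outx : exists x', connect routes x (class1_lift x').
  case: x => [i|[e r]]; first by exists (inl i); exact: connect0.
  by exists (inl (head e)); apply/connect1/routes_road_station.
have iny : exists y', connect routes (class1_lift y') y.
  case: y => [j|[f [|]]].
  - by exists (inl j); exact: connect0.
  - have [e ef] := road_into f.
    by exists (inr e); apply/connect1/routes_road_road.
  - by exists (inr f); exact: connect0.
have [[x' xx'] [y' y'y]] := (outx, iny).
exact: connect_trans xx' (connect_trans (class1_lift_connect x' y') y'y).
Qed.

Lemma routing_mx_irreducible : irreducible_mx (routing_mx road p alpha piK).
Proof.
apply: (connected_irreducible routing_mx_stochastic) => a b.
rewrite -(enum_valK a) -(enum_valK b).
apply: homo_connect (routing_connected _ _) => x y xy.
by apply: connect1; rewrite /= mxE !enum_rankK.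
Qed.

End Routing.

Theorem theorem1 (R : realType) (N : nat) (hN : (2 <= N)%N)
  (road : rel 'I_N) (road_irr : irreflexive road)
  (path_irr : irreducible_path_graph road)
  (p alpha : 'I_N -> 'I_N -> R) (piK : 'I_N -> R)
  (p_gt0 : forall i j, j \in Theta road i -> 0 < p i j)
  (p_sum1 : forall i, \sum_(j in Theta road i) p i j = 1)
  (alpha_gt0 : forall i j, j \in Theta road i -> 0 < alpha i j)
  (alpha_sum1 : forall i, \sum_(j in Theta road i) alpha i j = 1)
  (piK_itv : forall i, 0 < piK i < 1) :
  let P := routing_mx road p alpha piK in
  let station1 : 'I_N := Ordinal (ltnW hN) in
  [/\ irreducible_mx P,
      stochastic P
    & exists! e : 'rV[R]_#|vnode road|,
        [/\ forall a, 0 < e 0 a,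
            e = e *m P
          & e 0 (enum_rank (station road station1)) = 1]].
Proof.
move=> P station1.
have Pst : stochastic P by exact: routing_mx_stochastic.
have Pirr : irreducible_mx P by exact: routing_mx_irreducible.
by split=> //; exact: stationary_exists_unique.
Qed.
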